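(* For all positive integers $m,r$ and either choice of sign, the polynomial $(1+z^m)(1\pm z^r+z^{2r})+1$ is an integer expanding polynomial with leading coefficient $1$ and free term $\pm2$.
   Context: A polynomial is called expanding if all its complex roots have modulus strictly greater than $1$. An integer polynomial is a polynomial with integer coefficients. *)

(* Defs.v *)
From mathcomp Require Import all_boot all_order all_algebra.
From mathcomp Require Import complex reals.

Set Implicit Arguments.
Unset Strict Implicit.
Unset Printing Implicit Defensive.

Import Order.TTheory GRing.Theory Num.Theory.
Local Open Scope ring_scope.
Local Open Scope complex_scope.

(* The norm and the (partial) order are those of [R[i]]: [`|z|] is the modulus
   of [z] seen in [R[i]], and [1 < `|z|] compares real numbers. *)
Definition expanding (R : realType) (p : {poly R[i]}) : Prop :=
  forall z : R[i], root p z -> 1 < `|z|.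

Definition integer_poly (R : realType) (p : {poly R[i]}) : Prop :=
  forall k : nat, exists a : int, p`_k = a%:~R.

(* Main.v *)
Require Import Defs.
From mathcomp Require Import all_boot all_order all_algebra.
From mathcomp Require Import complex reals.
From mathcomp Require Import ring lra.

Import Order.TTheory GRing.Theory Num.Theory.
Local Open Scope ring_scope.
Local Open Scope complex_scope.

(** Let [w = s z^r] and [q = 1 + w + w^2]. At a root [z] the equation
    [(1 + z^m) q = -1] rearranges to [z^m q = -(1 + q)]. If [|z| <= 1], then
    [|1 + q| <= |q|], that is, [Re q <= -1/2]. But [|w| <= 1] with [x = Re w]
    gives [Re q >= 2 x^2 + x >= -1/8]. *)

(** This moves a comparison of moduli from the partial order of [R[i]] to polynomials over [R],
    where [nra] applies. *)
Lemma ler_normc_sqr (R : rcfType) (a b c d : R) :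
  (`|a +i* b| <= `|c +i* d|) = (a ^+ 2 + b ^+ 2 <= c ^+ 2 + d ^+ 2).
Proof.
by rewrite !normc_def /= lecR ler_sqrt // addr_ge0 // sqr_ge0.
Qed.

Lemma mul_add1_cyclotomic3_neqN1 (R : rcfType) (u w : R[i]) :
  `|u| <= 1 -> `|w| <= 1 -> (1 + u) * (1 + w + w ^+ 2) <> -1.
Proof.
move=> hu hw E.
have Eu : u * (1 + w + w ^+ 2) = - (1 + (1 + w + w ^+ 2)).
  by rewrite opprD -E [in RHS]mulrDl mul1r [RHS]addrC addKr.
have : `|1 + (1 + w + w ^+ 2)| <= `|1 + w + w ^+ 2|.
  by rewrite -normrN -Eu normrM ler_piMl.
clear E Eu; case: w hw => x y hw.
have {}hw : x ^+ 2 + y ^+ 2 <= 1 ^+ 2 + 0 ^+ 2.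
  by rewrite -ler_normc_sqr (le_trans hw) // normr1.
(* The sums such as [0 + y] stay unsimplified so that the equality holds by computation. *)
rewrite [1 + _ + _](_ : _ =
  (1 + x + (x * x - y * y)) +i* (0 + y + (x * y + y * x))) //.
rewrite [1 + (_ +i* _)](_ : _ =
  (1 + (1 + x + (x * x - y * y))) +i* (0 + (0 + y + (x * y + y * x)))) //.
rewrite ler_normc_sqr => hq.
(* The imaginary parts in [hq] cancel, leaving [1 + 2 Re q <= 0]. By [hw], [Re q >= 2 x^2 + x = ((4
   x + 1)^2 - 1) / 8]. *)
have := sqr_ge0 (4 * x + 1); nra.
Qed.

Theorem mainTheorem16 (R : realType) (m r : nat) (s : R[i])
    (hm : (0 < m)%N) (hr : (0 < r)%N) (hs : s = 1 \/ s = -1) :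
  let P : {poly R[i]} := (1 + 'X^m) * (1 + s *: 'X^r + 'X^(2 * r)) + 1 in
  [/\ integer_poly P,
      expanding P,
      lead_coef P = 1
    & P`_0 = 2 \/ P`_0 = -2].
Proof.
move=> P.
have [e def_s] : exists e : int, s = e%:~R.
  by case: hs => ->; [exists 1 | exists (-1)]; rewrite ?rmorphN.
have s2 : s ^+ 2 = 1 by case: hs => ->; rewrite ?sqrrN expr1n.
have ns : `|s| = 1 by case: hs => ->; rewrite ?normrN normr1.
split.
- move=> k.
  (* [P] is the image of this integer polynomial [Q]. *)
  pose Q : {poly int} := (1 + 'X^m) * (1 + e *: 'X^r + 'X^(2 * r)) + 1.
  exists Q`_k; rewrite -coef_map /=; congr (_`_k).
  by rewrite /P /Q !(rmorphD, rmorphM, rmorph1) /= map_polyZ !map_polyXn def_s.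
(* The order on [R[i]] is partial; negating [<] requires both sides to be real. *)
- move=> z /rootP Pz; rewrite real_ltNge ?normr_real ?real1 //.
  apply/negP => hz.
  apply: (@mul_add1_cyclotomic3_neqN1 R (z ^+ m) (s * z ^+ r)).
  + by rewrite normrX exprn_ile1.
  + by rewrite normrM ns mul1r normrX exprn_ile1.
  (* Since [s^2 = 1], the square of [s z^r] is [z^(2r)]. *)
  + apply/eqP; rewrite -addr_eq0 exprMn s2 mul1r -exprM mulnC -Pz.
    by rewrite /P !hornerE.
- have sA : size (1 + 'X^m : {poly R[i]}) = m.+1.
    by rewrite addrC size_polyDl size_polyXn // size_poly1.
  have lA : lead_coef (1 + 'X^m : {poly R[i]}) = 1.
    by rewrite lead_coefDr ?lead_coefXn // size_polyXn size_poly1.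
  (* As [r > 0], [r + 1 <= 2 r], so ['X^(2 * r)] dominates. *)
  have lt : (size (1 + s *: 'X^r)%R < size ('X^(2 * r) : {poly R[i]})%R)%N.
    rewrite size_polyXn ltnS (leq_trans (size_polyD _ _)) // geq_max size_poly1.
    rewrite muln_gt0 hr (leq_trans (size_scale_leq _ _)) // size_polyXn.
    by rewrite mul2n -addnn -addn1 leq_add2l.
  have lB : lead_coef (1 + s *: 'X^r + 'X^(2 * r) : {poly R[i]}) = 1.
    by rewrite lead_coefDr ?lead_coefXn.
  rewrite /P lead_coefDl ?lead_coefM ?lA ?lB ?mulr1 //.
  (* The leading coefficients multiply to [1], so the product has size [m + 2 r + 1 > 1], and adding
     [1] keeps its leading term. *)
  rewrite size_poly1 size_proper_mul ?lA ?lB ?mulr1 ?oner_neq0 // sA.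
  by rewrite addrC size_polyDl // size_polyXn addSn /= addnS ltnS addn_gt0 hm.
(* For either sign the value at [0] is [1 * 1 + 1 = 2]. *)
- left; rewrite -horner_coef0 /P !hornerE !expr0n !gtn_eqF ?muln_gt0 //.
  by rewrite !(mulr0, addr0, mulr1).
Qed.
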